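(* Consider an instance of the Multiple Drone-Delivery Scheduling Problem (MDSP) with $m$ drones of battery capacity $B$ and $n$ jobs, and let $\Delta$ be the maximum, over all jobs $j$, of the number of other jobs whose intervals intersect $I_j$. Let $\mathcal{S}^* = \{S^*_1,\dots,S^*_{2m+\Delta}\}$ be the family of $2m+\Delta$ assignments held by the drones at the end of the correction phase (Step 3) of the Modified Greedy Algorithm described in the context. Then $$\mathcal{P}(\mathcal{S}^* ) = \sum_{i=1}^{2m+\Delta}\mathcal{P}(S^*_i) \;\geq\; OPT,$$ where $OPT$ is the optimal value of the MDSP instance.
   Context: MDSP instance: there are $m$ identical drones, each with energy budget (battery) $B \ge 0$, and $n$ jobs (deliveries) $j=1,\dots,n$. Job $j$ has an open time interval $I_j=(t^L_j,t^R_j)$, an energy cost $c_j$ with $0\le c_j\le B$, and a reward $p_j\ge 0$. Two jobs $a,b$ conflict if $I_a\cap I_b\neq\varnothing$. An assignment is a set $S_i$ of jobs given to drone $i$; it is compatible if no two of its jobs conflict, and feasible if $\mathcal{W}(S_i)=\sum_{j\in S_i}c_j\le B$. Its reward is $\mathcal{P}(S_i)=\sum_{j\in S_i}p_j$, and the reward of a family of assignments is the sum of the rewards of its members. $OPT$ is the maximum of $\sum_{i=1}^m\mathcal{P}(S_i)$ over all families $(S_1,\dots,S_m)$ of pairwise disjoint, compatible, feasible assignments. The density of job $j$ is $d_j=p_j/c_j$ (taken as $+\infty$ if $c_j=0$). Modified Greedy Algorithm (uses $2m+\Delta$ drones, all initially with empty assignments): Step 1. Order the jobs so that $d_1\ge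 d_2\ge\dots\ge d_n$. Let $C=\varnothing$ be the set of critically-assigned drones. Step 2. For $j=1,\dots,n$: if $|C|\ge m$, stop this loop. Otherwise choose a drone $i\in\{1,\dots,m+\Delta\}\setminus C$ whose current assignment $S_i$ contains no job conflicting with $j$, and add $j$ to $S_i$; if now $\mathcal{W}(S_i)>B$, add $i$ to $C$ and set $L_i=j$. Step 3 (correction). Enumerate the critical drones as $i_1,\dots,i_{|C|}$. For the $k$-th critical drone $i=i_k$: if $\mathcal{P}(S_i\setminus\{L_i\})\ge p_{L_i}$, set $S_{m+\Delta+k}=\{L_i\}$ and $S_i=S_i\setminus\{L_i\}$; otherwise set $S_{m+\Delta+k}=S_i\setminus\{L_i\}$ and $S_i=\{L_i\}$. Step 4. Output the $m$ assignments of largest reward among the $2m+\Delta$ drones. *)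

(* Defs.v *)
(* MathComp, with classical sets and extended reals from MathComp-Analysis. *)
From mathcomp Require Import all_boot all_order all_algebra.
From mathcomp Require Import boolp classical_sets constructive_ereal.

Set Implicit Arguments.
Unset Strict Implicit.
Unset Printing Implicit Defensive.

Import Order.TTheory GRing.Theory Num.Theory.
Local Open Scope ring_scope.

Record mdsp (R : realFieldType) (m n : nat) := Mdsp {
  battery : R;
  tL : 'I_n -> R;
  tR : 'I_n -> R;
  cost : 'I_n -> R;
  profit : 'I_n -> R;
  battery_ge0 : 0 <= battery;
  cost_ge0 : forall j, 0 <= cost j;
  cost_le : forall j, cost j <= battery;
  profit_ge0 : forall j, 0 <= profit j
}.

Section Instance.
Variables (R : realFieldType) (m n : nat) (I : mdsp R m n).

Definition job_interval (j : 'I_n) : set R :=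
  [set t | tL I j < t < tR I j]%classic.

Definition conflict (a b : 'I_n) : bool :=
  `[< (job_interval a `&` job_interval b !=set0)%classic >].

Definition Delta : nat :=
  \max_(j < n) #|[set k : 'I_n | (k != j) && conflict j k]|.

Definition weight (S : {set 'I_n}) : R := \sum_(j in S) cost I j.

Definition reward (S : {set 'I_n}) : R := \sum_(j in S) profit I j.

Definition compatible (S : {set 'I_n}) : bool :=
  [forall a in S, forall b in S, (a != b) ==> ~~ conflict a b].

Definition feasible (S : {set 'I_n}) : bool := weight S <= battery I.

Definition solution (S : {ffun 'I_m -> {set 'I_n}}) : bool :=
  [forall i, compatible (S i) && feasible (S i)] &&
  [forall i, forall i', (i != i') ==> [disjoint S i & S i']].

(* The base value 0 is harmless: it is the reward of the everywhere empty
   family, which is a solution. *)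
Definition OPT : R :=
  \big[Num.max/0]_(S : {ffun 'I_m -> {set 'I_n}} | solution S)
    \sum_(i < m) reward (S i).

Definition density (j : 'I_n) : \bar R :=
  if cost I j == 0 then +oo%E else (profit I j / cost I j)%:E.

Definition density_order (s : seq 'I_n) : bool :=
  perm_eq s (enum 'I_n) && sorted (fun a b => density b <= density a)%E s.

(* Drones are numbered from 0: those of index < m + Delta serve the greedy
   loop, the remaining m are the spare ones filled by the correction. *)
Definition drone := 'I_(2 * m + Delta).

(* last_job plays the role of L, with L_i undefined encoded as None. *)
Record state := State {
  assigned : {ffun drone -> {set 'I_n}};
  critical : {set drone};
  last_job : {ffun drone -> option 'I_n}
}.

Definition init_state : state :=
  State [ffun => finset.set0] finset.set0 [ffun => None].

Definition available (st : state) (j : 'I_n) (i : drone) : bool :=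
  [&& (i < m + Delta)%N, i \notin critical st
    & [forall k in assigned st i, ~~ conflict k j]].

Definition add_job (st : state) (j : 'I_n) (i : drone) : state :=
  let Si := j |: assigned st i in
  let S' := [ffun i' => if i' == i then Si else assigned st i'] in
  if battery I < weight Si then
    State S' (i |: critical st)
      [ffun i' => if i' == i then Some j else last_job st i']
  else State S' (critical st) (last_job st).

(* The choice of an available drone is free, so the loop is a relation between
   initial and final states.  A run never gets stuck: see greedy_progress. *)
Inductive greedy_loop : seq 'I_n -> state -> state -> Prop :=
| greedy_end st : greedy_loop [::] st st
| greedy_stop j js st : (m <= #|critical st|)%N -> greedy_loop (j :: js) st st
| greedy_step j js st i st' :
    (#|critical st| < m)%N -> available st j i ->
    greedy_loop js (add_job st j i) st' ->
    greedy_loop (j :: js) st st'.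

Definition spare_drones : seq drone :=
  [seq i : drone <- enum drone | (m + Delta <= i)%N].

Definition correct1 (L : {ffun drone -> option 'I_n})
    (S : {ffun drone -> {set 'I_n}}) (ii' : drone * drone)
    : {ffun drone -> {set 'I_n}} :=
  let: (i, i') := ii' in
  if L i is Some l then
    let rest := S i :\ l in
    let: (kept, moved) :=
      if profit I l <= reward rest then (rest, [set l]) else ([set l], rest) in
    [ffun x => if x == i' then moved else if x == i then kept else S x]
  else S.

(* The k-th drone of the enumeration e is paired with the k-th spare drone;
   zip drops nothing from e because there are m spare drones and at most m
   critical ones: see spare_drones_enough. *)
Definition correction (st : state) (e : seq drone)
    : {ffun drone -> {set 'I_n}} :=
  foldl (correct1 (last_job st)) (assigned st) (zip e spare_drones).

(* S is a family that some run of the algorithm (some tie-breaking in the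
   order, some choices of drones, some enumeration of the critical drones)
   holds after the correction. *)
Definition modified_greedy (S : {ffun drone -> {set 'I_n}}) : Prop :=
  exists (s : seq 'I_n) (st : state) (e : seq drone),
    [/\ density_order s, greedy_loop s init_state st,
        perm_eq e (enum (critical st)) & S = correction st e].

Lemma conflict_sym a b : conflict a b = conflict b a.
Proof. by rewrite /conflict setIC. Qed.

Let inv (js : seq 'I_n) (st : state) :=
  (forall i k, k \in assigned st i -> k \in js) /\
  (forall i i' k, k \in assigned st i -> k \in assigned st i' -> i = i').

Let available_exists js st j : inv js st -> j \notin js ->
  (#|critical st| < m)%N -> exists i, available st j i.
Proof.
move=> [Hin Hdis] Hj Hm; apply/existsP; apply: contraT => /existsPn Hno.
pose D := [set i : drone | (i < m + Delta)%N] :\: critical st.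
have Hf i : i \in D -> exists k, (k \in assigned st i) && conflict k j.
  rewrite !inE => /andP[iC im]; have := Hno i.
  rewrite /available im iC /= => /forall_inPn[k kS /negPn kj].
  by exists k; rewrite kS.
pose f i := odflt j [pick k | (k \in assigned st i) && conflict k j].
have fP i : i \in D -> (f i \in assigned st i) && conflict (f i) j.
  move=> /Hf [k kP]; rewrite /f; case: pickP => [//|/(_ k)].
  by rewrite kP.
have finj : {in D &, injective f}.
  move=> i i' /fP/andP[fi _] /fP/andP[fi' _] E.
  by apply: (Hdis i i' (f i)) => //; rewrite E.
have le1 : (#|D| <= Delta)%N.
  rewrite -(card_in_imset finj).
  apply: leq_trans (leq_bigmax j); apply/subset_leq_card/fintype.subsetP => k.
  move=> /imsetP[i /fP/andP[fi fc] ->]; rewrite !inE conflict_sym fc andbT.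
  by apply: contraNneq Hj => <-; apply: Hin fi.
have : (m + Delta - #|critical st| <= #|D|)%N.
  have -> : (m + Delta = #|[set i : drone | (i < m + Delta)%N]|)%N.
    have le : (m + Delta <= 2 * m + Delta)%N.
      by rewrite leq_add2r mul2n -addnn leq_addr.
    rewrite -[LHS]card_ord -cardsT.
    have wI : injective (widen_ord le) by move=> x y /(congr1 val) E; apply: val_inj.
    rewrite -(card_imset _ wI); apply: eq_card => i.
    rewrite !inE; apply/imsetP/idP => [[k _ ->]|lt]; first exact: (ltn_ord k).
    by exists (Ordinal lt) => //; apply: val_inj.
  by rewrite cardsD leq_sub2l // subset_leq_card // subsetIr.
move=> /leq_trans/(_ le1).
by rewrite leq_subLR leq_add2r leqNgt Hm.
Qed.

Let assigned_add st j i : assigned (add_job st j i) =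
  [ffun i' => if i' == i then j |: assigned st i else assigned st i'].
Proof. by rewrite /add_job; case: ifP. Qed.

Let inv_add js st j i : inv js st -> j \notin js ->
  inv (rcons js j) (add_job st j i).
Proof.
move=> [Hin Hdis] Hj; split=> [i1 k|i1 i2 k]; rewrite assigned_add !ffunE.
  rewrite mem_rcons in_cons; case: eqP => _; rewrite ?inE.
    by case/predU1P=> [->|/Hin->]; rewrite ?eqxx ?orbT.
  by move=> /Hin->; rewrite orbT.
have jn x : j \notin assigned st x by apply: contra Hj; apply: Hin.
case: eqP => [->|_]; case: eqP => [->|_] //; rewrite ?inE.
- case/predU1P=> [->|]; first by rewrite (negPf (jn _)).
  exact: Hdis.
- by move=> kS /predU1P[kj|]; [move: kS; rewrite kj (negPf (jn _))|apply: Hdis].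
- exact: Hdis.
Qed.

Let progress_inv js1 js2 st : inv js1 st -> uniq (js1 ++ js2) ->
  exists st', greedy_loop js2 st st'.
Proof.
elim: js2 js1 st => [|j js2 IH] js1 st Hinv U; first by exists st; constructor.
case: (leqP m #|critical st|) => Hm; first by exists st; constructor.
have Hj : j \notin js1.
  by move: U; rewrite cat_uniq /= negb_or => /and3P[_ /andP[]].
have [i Hi] := available_exists Hinv Hj Hm.
have [|st' H] := IH _ _ (inv_add i Hinv Hj); first by rewrite cat_rcons.
by exists st'; apply: greedy_step H.
Qed.

Let inv_loop js1 js2 js3 st st' : inv js1 st -> uniq (js1 ++ js2 ++ js3) ->
  greedy_loop js2 st st' -> (m <= #|critical st'|)%N \/ inv (js1 ++ js2) st'.
Proof.
move=> Hinv U H; elim: H js1 Hinv U => [st1|j js st1 le|j js st1 i st2 _ _ _ IH].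
- by move=> js1 ? _; right; rewrite cats0.
- by left.
move=> js1 Hinv U; rewrite -cat_rcons; apply: IH.
  apply: inv_add => //.
  by move: U; rewrite cat_uniq /= negb_or => /and3P[_ /andP[]].
by rewrite cat_rcons.
Qed.

Lemma greedy_progress js1 js2 st : uniq (js1 ++ js2) ->
  greedy_loop js1 init_state st -> exists st', greedy_loop js2 st st'.
Proof.
move=> U H; have I0 : inv [::] init_state.
  by split=> [i k|i i' k]; rewrite ffunE inE.
have [le|Hinv] := inv_loop (js3 := js2) I0 U H; last exact: progress_inv Hinv U.
by case: js2 {U} => [|j js]; exists st; constructor.
Qed.

Lemma spare_drones_enough js st : greedy_loop js init_state st ->
  (#|critical st| <= size spare_drones)%N.
Proof.
move=> H; have -> : size spare_drones = m.
  rewrite size_filter -(count_map val (fun k => m + Delta <= k)%N).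
  rewrite val_enum_ord mul2n -addnn -addnA (addnC m (m + _)%N) iotaD count_cat.
  rewrite (_ : count _ _ = 0%N); last first.
    apply/eqP; rewrite -leqn0 leqNgt -has_count; apply/hasPn => k.
    by rewrite mem_iota /= add0n -ltnNge.
  apply/eqP; rewrite add0n -[X in _ == X](size_iota (0 + (m + Delta))%N m).
  by rewrite -all_count; apply/allP => k; rewrite mem_iota => /andP[].
have : (#|critical init_state| <= m)%N by rewrite cards0.
elim: H => // j js1 st1 i st2 lt _ _ IH _; apply: IH.
rewrite /add_job; case: ifP => _ /=; last exact: ltnW.
rewrite cardsU1; apply: leq_trans lt.
by apply: (@leq_add _ _ 1); rewrite ?leq_b1.
Qed.

Lemma modified_greedy_exists : exists S, modified_greedy S.
Proof.
pose s := sort (fun a b => density b <= density a)%E (enum 'I_n).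
have ps : perm_eq s (enum 'I_n) by rewrite perm_sort.
have [|st H] := @greedy_progress [::] s init_state _ (greedy_end _).
  by rewrite (perm_uniq ps) enum_uniq.
exists (correction st (enum (critical st))), s, st, (enum (critical st)).
split=> //; rewrite /density_order ps /=.
by apply: sort_sorted => a b; apply: le_total.
Qed.

End Instance.

(* Main.v *)
(** Summed over all drones, the assignments of the greedy loop form a prefix of
    the density order, and the correction only splits assignments, so the final
    family has the profit of that prefix.  If the loop was not stopped, the
    prefix contains all jobs.  Otherwise [m] drones are overloaded and the prefix
    weighs more than [m * B], hence more than any solution; being greedy for the
    density, it then has at least the profit of any solution. *)
Require Import Defs.
From mathcomp Require Import all_boot all_order all_algebra.
From mathcomp Require Import constructive_ereal.

Set Implicit Arguments.
Unset Strict Implicit.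
Unset Printing Implicit Defensive.

Import Order.TTheory GRing.Theory Num.Theory.
Local Open Scope ring_scope.

Section Greedy.
Variables (R : realFieldType) (m n : nat) (I : mdsp R m n).
Implicit Types (st : state I) (js : seq 'I_n) (O : {set 'I_n}).
Implicit Types (S : {ffun drone I -> {set 'I_n}}).

Lemma assigned_add_job st j i : assigned (add_job st j i) =
  [ffun x => if x == i then j |: assigned st i else assigned st x].
Proof. by rewrite /add_job; case: ifP. Qed.

(** Here [js] is the list of jobs processed so far. Summing an arbitrary [f] says in one clause that
    the assignments partition [js]; it is used for profits and for costs. *)
Definition loop_inv js st : Prop :=
  [/\ forall i k, k \in assigned st i -> k \in js,
      forall f : 'I_n -> R,
        \sum_i \sum_(k in assigned st i) f k = \sum_(k <- js) f k,
      forall i, i \in critical st ->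
        (i < m + Delta I)%N /\ battery I < weight I (assigned st i)
    & forall i : drone I, (m + Delta I <= i)%N -> assigned st i = set0].

Lemma loop_inv_init : loop_inv [::] (init_state I).
Proof.
split=> [i k|f|i|i _]; rewrite ?ffunE ?inE // big_nil big1 // => i _.
by rewrite ffunE big_set0.
Qed.

Lemma loop_inv_add js st j i : loop_inv js st -> j \notin js ->
  available st j i -> loop_inv (rcons js j) (add_job st j i).
Proof.
case=> Hin Hsum Hcrit Hspare Hj /and3P[im iC _].
have jS : j \notin assigned st i by apply: contra Hj; apply: Hin.
split=> [x k|f|x|x mx]; rewrite ?assigned_add_job ?ffunE.
- rewrite mem_rcons in_cons; case: eqP => _; rewrite ?inE.
    by case/predU1P=> [->|/Hin->]; rewrite ?eqxx ?orbT.
  by move=> /Hin->; rewrite orbT.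
- rewrite -cats1 big_cat big_seq1 /= -Hsum (bigD1 i) //= ffunE eqxx big_setU1 //=.
  rewrite [in RHS](bigD1 i) //= -addrA [RHS]addrC; do 2 congr (_ + _).
  by apply: eq_bigr => x /negPf xi; rewrite ffunE xi.
(* The loop never adds to a critical drone, so drones that were already critical keep their
   overloaded sets. *)
- have old : x \in critical st ->
      (x < m + Delta I)%N /\ battery I < weight I
        (if x == i then j |: assigned st i else assigned st x).
    by move=> xC; case: eqP => [xi|_]; [rewrite -xi xC in iC|apply: Hcrit].
  rewrite /add_job; case: ifP => //= wi /setU1P[->|//].
  by rewrite eqxx.
- by case: eqP => [xi|_]; [rewrite leqNgt xi im in mx|apply: Hspare].
Qed.

(** The loop may stop early: [js3] is the part of the order it has processed and [js4] the part cut
    off. *)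
Lemma loop_inv_run js1 js2 st st' : loop_inv js1 st -> uniq (js1 ++ js2) ->
  greedy_loop js2 st st' ->
  exists js3 js4, [/\ js1 ++ js2 = js3 ++ js4, loop_inv js3 st'
    & js4 = [::] \/ (m <= #|critical st'|)%N].
Proof.
move=> Hinv U H; elim: H js1 Hinv U => [st1|j js st1 le|j js st1 i st2 _ av _ IH].
- by move=> js1 ? _; exists js1, [::]; split=> //; left.
- by move=> js1 ? _; exists js1, (j :: js); split=> //; right.
move=> js1 Hinv U; rewrite -cat_rcons; apply: IH; last by rewrite cat_rcons.
apply: loop_inv_add => //.
by move: U; rewrite cat_uniq /= negb_or => /and3P[_ /andP[]].
Qed.

Lemma reward_ge0 O : 0 <= reward I O.
Proof. by apply: sumr_ge0 => j _; apply: profit_ge0. Qed.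

(** The inequality allows [l] outside [O], so the correction can be analysed for an arbitrary [L],
    with no invariant tying [last_job] to the assignments. *)
Lemma reward_split O l : reward I O <= reward I [set l] + reward I (O :\ l).
Proof.
have [lO|lO] := boolP (l \in O).
  by rewrite /reward big_set1 (big_setD1 l).
by rewrite (setDidPl _) ?lerDr ?reward_ge0 // disjoint_sym disjoints1.
Qed.

Lemma correct1_reward L S i i' : i != i' -> S i' = set0 ->
  \sum_x reward I (S x) <= \sum_x reward I (correct1 L S (i, i') x).
Proof.
move=> ii' S0; rewrite /correct1; case: (L i) => [l|//].
rewrite (bigD1 i) // (bigD1 i') 1?eq_sym //= S0 {2}/reward big_set0 add0r.
case: ifP => _; rewrite [leRHS](bigD1 i) // [in leRHS](bigD1 i') 1?eq_sym //=;
  rewrite !ffunE (negPf ii') !eqxx addrA;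
  (apply: lerD; first by rewrite ?reward_split // addrC reward_split);
  apply: ler_sum => x /andP[/negPf xi /negPf xi'];
  by rewrite ffunE xi xi'.
Qed.

Lemma correct1_other L S i i' x : x != i -> x != i' ->
  correct1 L S (i, i') x = S x.
Proof.
move=> /negPf xi /negPf xi'; rewrite /correct1; case: (L i) => [l|//].
by case: ifP => _; rewrite ffunE xi xi'.
Qed.

(** A step alters only its own pair of drones, so the spare drones still to come stay empty. *)
Lemma foldl_correct1_reward L (e sp : seq (drone I)) S :
  uniq sp -> {in sp, forall x, x \notin e} -> {in sp, forall x, S x = set0} ->
  \sum_x reward I (S x) <=
    \sum_x reward I (foldl (correct1 L) S (zip e sp) x).
Proof.
elim: e sp S => [|i e IH] [|i' sp] S //= /andP[i'sp usp] spe S0.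
have ii' : i != i'.
  have := spe i' (mem_head _ _); rewrite inE negb_or eq_sym.
  by case/andP.
apply: le_trans (correct1_reward L ii' (S0 _ (mem_head _ _))) _.
apply: IH => // x xsp; have xin : x \in i' :: sp by rewrite inE xsp orbT.
  by have := spe x xin; rewrite inE negb_or => /andP[].
rewrite correct1_other ?S0 //.
  by have := spe x xin; rewrite inE negb_or => /andP[].
by apply: contraNneq i'sp => <-.
Qed.

Lemma correction_reward js st (e : seq (drone I)) :
  loop_inv js st -> perm_eq e (enum (critical st)) ->
  \sum_(k <- js) profit I k <= \sum_x reward I (correction st e x).
Proof.
case=> _ Hsum Hcrit Hspare pe; rewrite -Hsum; apply: foldl_correct1_reward.
- by rewrite filter_uniq ?enum_uniq.
- move=> x; rewrite mem_filter => /andP[mx _].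
  rewrite (perm_mem pe) mem_enum; apply/negP => /Hcrit[lt _].
  by rewrite leqNgt lt in mx.
- by move=> x; rewrite mem_filter => /andP[mx _]; apply: Hspare.
Qed.

Lemma loop_inv_weight js st : loop_inv js st -> (0 < m)%N ->
  (m <= #|critical st|)%N -> battery I *+ m < \sum_(k <- js) cost I k.
Proof.
case=> _ Hsum Hcrit _ m0 mC; rewrite -Hsum.
have wge0 i : 0 <= weight I (assigned st i).
  by apply: sumr_ge0 => j _; apply: cost_ge0.
(* One critical drone is needed to make the comparison of sums strict. *)
have [i iC] : exists i, i \in critical st.
  by apply/set0Pn; rewrite -card_gt0 (leq_trans m0).
apply: (@lt_le_trans _ _ (\sum_(i in critical st) weight I (assigned st i))).
  apply: (@le_lt_trans _ _ (\sum_(i in critical st) battery I)).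
    by rewrite sumr_const ler_wpMn2l ?battery_ge0.
  apply: ltr_sum => [|x /Hcrit[]//].
  by apply/hasP; exists i; rewrite ?mem_index_enum.
rewrite [leRHS](bigID (mem (critical st))) /= lerDl.
by apply: sumr_ge0 => x _; apply: wge0.
Qed.

Lemma solution_weight (T : {ffun 'I_m -> {set 'I_n}}) : solution I T ->
  \sum_(j in \bigcup_i T i) cost I j <= battery I *+ m.
Proof.
case/andP=> /forallP feas /forallP dis.
rewrite partition_disjoint_bigcup /=; last first.
  by move=> i i' ii'; have /forallP/(_ i')/implyP := dis i; apply.
rewrite -[X in _ *+ X]card_ord -sumr_const; apply: ler_sum => i _.
by have /andP[_] := feas i.
Qed.

Lemma solution_reward (T : {ffun 'I_m -> {set 'I_n}}) : solution I T ->
  \sum_i reward I (T i) = reward I (\bigcup_i T i).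
Proof.
case/andP=> _ /forallP dis; rewrite [RHS]partition_disjoint_bigcup //= => i i' ii'.
by have /forallP/(_ i')/implyP := dis i; apply.
Qed.

(** Multiplied out, the comparison also covers [a] of zero cost and density [+oo]: its left side
    then vanishes. *)
Lemma density_ge_profit a h : 0 < cost I h -> (density I h <= density I a)%E ->
  profit I h / cost I h * cost I a <= profit I a.
Proof.
move=> ch; rewrite /density (gt_eqF ch).
case: eqP => [-> _|/eqP ca]; first by rewrite mulr0 profit_ge0.
by rewrite lee_fin => le; rewrite -ler_pdivlMr // lt_def ca cost_ge0.
Qed.

Lemma density_le_profit a h : 0 < cost I h -> (density I a <= density I h)%E ->
  profit I a <= profit I h / cost I h * cost I a.
Proof.
move=> ch; rewrite /density (gt_eqF ch).
case: eqP => [_|/eqP ca]; first by rewrite leye_eq.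
by rewrite lee_fin => le; rewrite -ler_pdivrMr // lt_def ca cost_ge0.
Qed.

(** Fractional knapsack argument: the prefix jobs outside [O] are at least as dense as the jobs of
    [O] outside the prefix, and outweigh them in total. *)
Lemma prefix_reward js1 js2 O : density_order I (js1 ++ js2) ->
  \sum_(j in O) cost I j < \sum_(j <- js1) cost I j ->
  reward I O <= \sum_(j <- js1) profit I j.
Proof.
case/andP=> ps so wO.
have sumO f : \sum_(j in O) f j =
    \sum_(j <- js1 | j \in O) f j + \sum_(j <- js2 | j \in O) f j :> R.
  by rewrite -big_cat (perm_big _ ps) /= big_enum_cond.
have sub_sum (f : 'I_n -> R) : {in js1, forall j, 0 <= f j} ->
    \sum_(j <- js1 | j \in O) f j <= \sum_(j <- js1) f j.
  move=> f0; rewrite [leRHS](bigID (mem O)) /= lerDl big_seq_cond.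
  by apply: sumr_ge0 => j /andP[/f0].
(* If no job is excluded there is no threshold job [h], but the prefix then contains [O]. *)
case: js2 => [|h js2] in ps so sumO *.
  by rewrite /reward sumO big_nil addr0 sub_sum // => j _; apply: profit_ge0.
have tr : transitive (fun a b => (density I b <= density I a)%E).
  by move=> b a c ab bc; apply: le_trans bc ab.
move: so; rewrite sorted_pairwise // pairwise_cat => /and3P[/allrelP H1 _].
rewrite pairwise_cons => /andP[/allP H2 _].
have {}H1 j : j \in js1 -> (density I h <= density I j)%E.
  by move=> jj; apply: H1 => //; apply: mem_head.
(* If [h] cost nothing, its density [+oo] would force zero cost on the whole prefix, which could not
   outweigh [O]. *)
have ch : 0 < cost I h.
  rewrite lt_def cost_ge0 andbT; apply: contraTneq wO => ch.
  rewrite -leNgt big_seq big1 ?sumr_ge0 // => [j _|j /H1]; first exact: cost_ge0.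
  by rewrite /density ch eqxx; case: eqP.
(* Lagrangian relaxation: with the density [d] of the first excluded job as
   multiplier, [profit - d * cost] is nonnegative on the prefix and nonpositive after it. *)
pose d := profit I h / cost I h; pose g j := profit I j - d * cost I j.
have sumg js (P : pred 'I_n) : \sum_(j <- js | P j) profit I j =
    \sum_(j <- js | P j) g j + d * \sum_(j <- js | P j) cost I j.
  by rewrite mulr_sumr -big_split; apply: eq_bigr => j _; rewrite /= subrK.
rewrite /reward !sumg; apply: lerD; last first.
  by rewrite ler_wpM2l ?(ltW wO) // divr_ge0 ?profit_ge0 ?cost_ge0.
rewrite sumO -[leRHS]addr0; apply: lerD.
  by apply: sub_sum => j /H1; rewrite subr_ge0; apply: density_ge_profit.
rewrite big_seq_cond; apply: sumr_le0 => j /andP[jh _].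
rewrite subr_le0; apply: density_le_profit => //.
by move: jh; rewrite inE => /predU1P[->//|/H2].
Qed.

End Greedy.

Theorem theorem4 (R : realFieldType) (m n : nat) (I : mdsp R m n)
    (S : {ffun drone I -> {set 'I_n}}) :
  modified_greedy S ->
  OPT I <= \sum_(i < 2 * m + Delta I) reward I (S i).
Proof.
case=> s [st [e [ds run pe ->]]].
have us : uniq s by case/andP: ds => ps _; rewrite (perm_uniq ps) enum_uniq.
have [js1 [js2 [/= sE inv stop]]] := loop_inv_run (loop_inv_init I) us run.
apply: bigmax_le => [|T solT]; first by rewrite sumr_ge0 // => i _; exact: reward_ge0.
apply: le_trans (correction_reward inv pe).
(* Without drones the prefix is empty and the strict weight bound would read [0 < 0]; the reward of
   a solution is then an empty sum. *)
have [m0|m_gt0] := posnP m.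
  rewrite big1 ?sumr_ge0 // => [j _|i _]; first exact: profit_ge0.
  by have := ltn_ord i; rewrite {2}m0.
rewrite solution_reward //; case: stop => [js20|mC].
  rewrite sE js20 cats0 in ds; case/andP: ds => ps _.
  rewrite (perm_big _ ps) /= big_enum /= [leRHS](bigID (mem (\bigcup_i T i))) /=.
  by rewrite lerDl sumr_ge0 // => j _; apply: profit_ge0.
apply: (@prefix_reward _ _ _ _ _ js2); first by rewrite -sE.
exact: le_lt_trans (solution_weight solT) (loop_inv_weight inv m_gt0 mC).
Qed.
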